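(* Let $\mathfrak g$, $\tau$ and the relations (R) on the generators $\mathbf h_{k,r},\mathbf b_{k,r}$ ($k\in\mathbb I$, $r\in\{0,1\}$) be as in the context. Suppose that $i\in\mathbb I_1$, $j\in\mathbb I_0$, and $$c_{i,\tau i}=0,\qquad c_{ij}=c_{\tau i,j}=c_{ji}=c_{j,\tau i}=-1.$$ Then the relations (R) (which do not include the following relation) imply $$\big[\mathbf h_{i,1},[\mathbf b_{i,1},\mathbf b_{\tau i,1}]\big]=0 .$$ The hypotheses hold for the unique nontrivial $\tau$-orbit in type $\mathsf A_3$ and in type $\mathsf D_r$.
   Context: Algebras are unital associative over $\mathbb C$, $[x,y]=xy-yx$. $\mathfrak g$ is a simple Lie algebra with simply-laced Cartan matrix $(c_{ij})_{i,j\in\mathbb I}$ and $\tau$ is a nontrivial involution of its Dynkin diagram ($c_{\tau i,\tau j}=c_{ij}$). $\mathbb I_0=\{i\in\mathbb I:\tau i=i\}$ and $\mathbb I_1$ is a set of representatives of the $\tau$-orbits of length $2$, chosen so that its induced Dynkin subdiagram is connected. Relations (R), for all $i,j\in\mathbb I$: - $[\mathbf h_{i,r},\mathbf h_{j,s}]=0$ and $\mathbf h_{i,r}=(-1)^{r+1}\mathbf h_{\tau i,r}$ for $0\le r,s\le1$; - $[\mathbf h_{i,0},\mathbf b_{j,r}]=(c_{ij}-c_{\tau i,j})\mathbf b_{j,r}$ for $0\le r\le1$; - $[\mathbf h_{i,1},\mathbf b_{j,0}]=(c_{ij}+c_{\tau i,j})\mathbf b_{j,1}$; - $[\mathbf b_{i,1},\mathbf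 b_{j,0}]=[\mathbf b_{i,0},\mathbf b_{j,1}]-2\delta_{\tau i,j}\mathbf h_{j,1}$; - $[\mathbf b_{i,r},\mathbf b_{\tau i,s}]=(-1)^r\mathbf h_{\tau i,r+s}$ if $r+s\le1$ and $c_{i,\tau i}=0$; - $[\mathbf b_{i,0},\mathbf b_{j,0}]=\delta_{\tau i,j}\mathbf h_{j,0}$ if $c_{ij}=0$; - $[\mathbf b_{i,0},[\mathbf b_{i,0},\mathbf b_{\tau i,0}]]=4\mathbf b_{i,0}$ if $c_{i,\tau i}=-1$; - $[\mathbf b_{i,0},[\mathbf b_{i,0},\mathbf b_{j,0}]]=0$ if $c_{ij}=-1$ and $i\ne\tau i\ne j$; - $[\mathbf b_{i,0},[\mathbf b_{i,0},\mathbf b_{j,0}]]=-\mathbf b_{j,0}$ if $c_{ij}=-1$ and $i=\tau i$. *)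

(* Defs.v *)
From mathcomp Require Import all_boot all_order all_algebra.
From mathcomp Require Import reals complex.

Set Implicit Arguments.
Unset Strict Implicit.
Unset Printing Implicit Defensive.

Import Order.TTheory GRing.Theory Num.Theory.
Local Open Scope ring_scope.

Section Diagrams.

Variable I : finType.
Implicit Types (c : I -> I -> int) (tau : I -> I) (S : {set I}).

(* Connectedness of the subdiagram induced on S; distinct nodes x, y are
   joined when c x y != 0. *)
Definition subdiagram_connected c S : Prop :=
  {in S &, forall x y,
    connect [rel u v | [&& u \in S, v \in S & c u v != 0]] x y}.

(* Simply-laced Cartan matrices of simple Lie algebras, i.e. the nonempty
   indecomposable Cartan matrices of finite type with off-diagonal entries
   in {0, -1}.  Since the entries are integers, positive definiteness over
   the rationals and over the reals agree. *)
Record simply_laced_cartan c : Prop := SimplyLacedCartan {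
  cartan_nonempty : (0 < #|I|)%N;
  cartan_diag : forall i, c i i = 2;
  cartan_offdiag : forall i j, i != j -> c i j = 0 \/ c i j = -1;
  cartan_sym : forall i j, c i j = c j i;
  cartan_posdef : forall x : {ffun I -> rat}, x != 0 ->
    0 < \sum_i \sum_j (c i j)%:~R * x i * x j;
  cartan_indecomposable : subdiagram_connected c [set: I] }.

Record nontrivial_diagram_involution c tau : Prop :=
  NontrivialDiagramInvolution {
  diag_invol_K : involutive tau;
  diag_invol_cartan : forall i j, c (tau i) (tau j) = c i j;
  diag_invol_nontrivial : exists i, tau i != i }.

Definition fixed_nodes tau : {set I} := [set i | tau i == i].

Definition moved_nodes tau : {set I} := [set i | tau i != i].

Definition orbits2 tau : {set {set I}} :=
  [set [set i; tau i] | i in moved_nodes tau].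

Definition connected_representatives c tau (I1 : {set I}) : Prop :=
  is_transversal I1 (orbits2 tau) (moved_nodes tau)
  /\ subdiagram_connected c I1.

Definition lemma_hypotheses c tau (I1 : {set I}) (i j : I) : Prop :=
  [/\ i \in I1, j \in fixed_nodes tau, c i (tau i) = 0 &
      [/\ c i j = -1, c (tau i) j = -1, c j i = -1 & c j (tau i) = -1]].

End Diagrams.

Section StandardTypes.

Definition cartan_of_edges (n : nat) (e : rel nat) (i j : 'I_n) : int :=
  if i == j then 2 else if e i j || e j i then -1 else 0.

(* 0 - 1 - ... - (n-1) *)
Definition edge_A : rel nat := fun a b => b == a.+1.

(* 0 - 1 - ... - (r-3), with two leaves r-2 and r-1 attached to r-3 *)
Definition edge_D (r : nat) : rel nat := fun a b =>
  ((b == a.+1) && (b.+1 < r)%N) || ((a.+3 == r) && (b.+1 == r)).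

Definition cartan_equiv (I J : finType) (c : I -> I -> int)
    (d : J -> J -> int) : Prop :=
  exists f : I -> J, bijective f /\ forall i j, c i j = d (f i) (f j).

Definition type_A (n : nat) (I : finType) (c : I -> I -> int) : Prop :=
  cartan_equiv c (cartan_of_edges (n := n) edge_A).

Definition type_D (r : nat) (I : finType) (c : I -> I -> int) : Prop :=
  (4 <= r)%N /\ cartan_equiv c (cartan_of_edges (n := r) (edge_D r)).

End StandardTypes.

Definition lie (A : pzRingType) (x y : A) : A := x * y - y * x.

(* The generators are h i r and b i r with r = 0, 1 only; the values of h and
   b at r >= 2 are not constrained. *)
Record relationsR (I : finType) (c : I -> I -> int) (tau : I -> I)
    (A : pzRingType) (h b : I -> nat -> A) : Prop := RelationsR {
  relR_hh : forall i j r s, (r <= 1)%N -> (s <= 1)%N ->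
    lie (h i r) (h j s) = 0;
  relR_htau : forall i r, (r <= 1)%N ->
    h i r = (-1) ^+ r.+1 * h (tau i) r;
  relR_h0b : forall i j r, (r <= 1)%N ->
    lie (h i 0%N) (b j r) = b j r *~ (c i j - c (tau i) j);
  relR_h1b : forall i j,
    lie (h i 1%N) (b j 0%N) = b j 1%N *~ (c i j + c (tau i) j);
  relR_b1b0 : forall i j,
    lie (b i 1%N) (b j 0%N) =
    lie (b i 0%N) (b j 1%N) - (h j 1%N *+ 2) *+ (tau i == j);
  relR_bbtau : forall i r s, (r + s <= 1)%N -> c i (tau i) = 0 ->
    lie (b i r) (b (tau i) s) = (-1) ^+ r * h (tau i) (r + s)%N;
  relR_b0b0 : forall i j, c i j = 0 ->
    lie (b i 0%N) (b j 0%N) = h j 0%N *+ (tau i == j);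
  relR_serre_tau : forall i, c i (tau i) = -1 ->
    lie (b i 0%N) (lie (b i 0%N) (b (tau i) 0%N)) = b i 0%N *+ 4;
  relR_serre : forall i j, c i j = -1 -> i != tau i -> tau i != j ->
    lie (b i 0%N) (lie (b i 0%N) (b j 0%N)) = 0;
  relR_serre_fixed : forall i j, c i j = -1 -> i = tau i ->
    lie (b i 0%N) (lie (b i 0%N) (b j 0%N)) = - b j 0%N }.

(* Main.v *)
(* Write x_r, y_r, z_r for b i r, b (tau i) r, b j r, and put H = h i 1,
   K = h j 1, T = H + K, W = [x_1, y_1].  The derivation ad T kills x_r and y_r
   for r = 0, 1 and maps z_0 to 2 z_1, while ad (H + T) kills z_0 and z_1.  Since
   T commutes with W and K = [z_0, z_1], everything follows from [W, z_0] = 0: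
   ad T then gives [W, z_1] = 0, hence [W, K] = 0 and [W, H] = [W, T] = 0.
   For [W, z_0] = 0 put z_2 = [T, z_1], so that [x_0, z_2] = 2 [x_1, z_1] and
   [y_0, z_2] = 2 [y_1, z_1], and compare the Jacobi identities for
   (x_0, y_1, z_1), (x_1, y_0, z_1) and (x_0, y_0, z_2), in which [x_0, y_1] = H,
   [x_1, y_0] = - H, and [x_0, y_0] = h (tau i) 0 commutes with z_2.  The Serre
   relations are not involved.

   Both A_3 and D_r are diagrams D_(m+3), with m = 0 for A_3.  Their Cartan form
   is y_0^2 + sum_(k < m) (y_k - y_(k+1))^2 + (y_m - y_(m+1) - y_(m+2))^2
   + (y_(m+1) - y_(m+2))^2.  A diagram involution fixes the branching node m, and
   unless m = 1 it fixes the whole chain 0, ..., m, by descent from m. *)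
Require Import Defs.
From mathcomp Require Import all_boot all_order all_algebra.
From mathcomp Require Import reals complex.
From mathcomp Require Import zify ring lra.

Set Implicit Arguments.
Unset Strict Implicit.
Unset Printing Implicit Defensive.

Import Order.TTheory GRing.Theory Num.Theory.
Local Open Scope ring_scope.

(** * The commutator bracket as a derivation *)

Section LieBracket.

Variable A : pzRingType.
Implicit Types x y z t : A.

Lemma lieC x y : lie x y = - lie y x.
Proof. by rewrite /lie opprB. Qed.

Lemma lie0 x : lie x 0 = 0.
Proof. by rewrite /lie mulr0 mul0r subrr. Qed.

Lemma lie0l x : lie 0 x = 0.
Proof. by rewrite lieC lie0 oppr0. Qed.

Lemma liexx x : lie x x = 0.
Proof. exact: subrr. Qed.

Lemma lieDl x y z : lie (x + y) z = lie x z + lie y z.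
Proof. by rewrite /lie mulrDl mulrDr opprD addrACA. Qed.

Lemma lieNl x y : lie (- x) y = - lie x y.
Proof. by rewrite /lie mulNr mulrN opprB opprK addrC. Qed.

Lemma lieMnr x y n : lie x (y *+ n) = lie x y *+ n.
Proof. by rewrite /lie mulrnAl mulrnAr mulrnBl. Qed.

Lemma lie_jacobi x y z : lie x (lie y z) = lie (lie x y) z + lie y (lie x z).
Proof.
rewrite /lie !mulrBr !mulrBl !mulrA !opprB.
rewrite [RHS]addrACA !subrKA [LHS]addrACA [RHS]addrACA.
by rewrite [- (y * z * x) + _]addrC.
Qed.

Lemma lie_lie x y z : lie (lie x y) z = lie x (lie y z) - lie y (lie x z).
Proof. by rewrite lie_jacobi addrK. Qed.

Lemma lie_commute_lie t x y :
  lie t x = 0 -> lie t y = 0 -> lie t (lie x y) = 0.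
Proof.
by move=> tx ty; rewrite lie_jacobi tx ty lie0 lie0l addr0.
Qed.

Lemma lie_jacobi_commute t x y : lie t x = 0 ->
  lie t (lie x y) = lie x (lie t y).
Proof. by move=> tx; rewrite lie_jacobi tx lie0l add0r. Qed.

End LieBracket.

(** * The bracket relation; [two_inj] serves to halve, since [H] and [T] produce [x1], [y1], [z1]
    only doubled *)

Lemma lie_h1_lie_b1_btau1 (A : pzRingType) (I : finType) (c : I -> I -> int)
    (tau : I -> I) (h b : I -> nat -> A) (i j : I) :
    (forall x : A, x *+ 2 = 0 -> x = 0) ->
    simply_laced_cartan c -> nontrivial_diagram_involution c tau ->
    tau j = j -> c i (tau i) = 0 -> c i j = -1 ->
    relationsR c tau h b ->
  lie (h i 1%N) (lie (b i 1%N) (b (tau i) 1%N)) = 0.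
Proof.
move=> two_inj [_ cdiag _ csym _ _] [tauK tauc _] tauj cit cij rel.
have cii := cdiag i; have cjj := cdiag j; have ctt := cdiag (tau i).
have cti : c (tau i) i = 0 by rewrite csym.
have ctj : c (tau i) j = -1 by rewrite -{1}tauj tauc.
have cji : c j i = -1 by rewrite csym.
have cjt : c j (tau i) = -1 by rewrite csym.
have tij : (tau i == j) = false.
  by apply/eqP => tij; move: cjt; rewrite tij cjj.
have hti : h (tau i) 1%N = h i 1%N.
  by rewrite (relR_htau rel i (leqnn 1)) expr2 mulrNN !mul1r.
set H := h i 1%N; set K := h j 1%N.
set x0 := b i 0%N; set x1 := b i 1%N.
set y0 := b (tau i) 0%N; set y1 := b (tau i) 1%N.
set z0 := b j 0%N; set z1 := b j 1%N.
have HK : lie H K = 0 by exact: (relR_hh rel).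
have Hx0 : lie H x0 = x1 *+ 2 by rewrite (relR_h1b rel) cii cti.
have Hy0 : lie H y0 = y1 *+ 2 by rewrite (relR_h1b rel) cit ctt.
have Hz0 : lie H z0 = - (z1 *+ 2) by rewrite (relR_h1b rel) cij ctj.
have Kx0 : lie K x0 = - (x1 *+ 2) by rewrite (relR_h1b rel) tauj cji.
have Ky0 : lie K y0 = - (y1 *+ 2) by rewrite (relR_h1b rel) tauj cjt.
have Kz0 : lie K z0 = z1 *+ 4 by rewrite (relR_h1b rel) tauj cjj.
(* As [tau j = j], (R) reads [z_1, z_0] = [z_0, z_1] - 2 K; antisymmetry gives 2 [z_0, z_1] = 2
   K. *)
have zz : lie z0 z1 = K.
  have := relR_b1b0 rel j j; rewrite tauj eqxx mulr1n -/z0 -/z1 -/K.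
  rewrite lieC => /eqP; rewrite -subr_eq0 -opprB oppr_eq0 opprK.
  rewrite addrAC -mulr2n -mulrnBl => /eqP /two_inj /eqP.
  by rewrite subr_eq0 => /eqP.
have xz : lie x1 z0 = lie x0 z1 by rewrite (relR_b1b0 rel) tij subr0.
have yz : lie y1 z0 = lie y0 z1.
  have -> : lie y1 z0 = lie y0 z1 - (K *+ 2) *+ (tau (tau i) == j).
    exact: (relR_b1b0 rel).
  rewrite tauK; case: eqP => [ij|_]; last by rewrite subr0.
  by move: cij; rewrite ij cjj.
have xy01 : lie x0 y1 = H by rewrite (relR_bbtau rel) // expr0 mul1r hti.
have xy10 : lie x1 y0 = - H by rewrite (relR_bbtau rel) // expr1 mulN1r hti.
have xy00 : lie x0 y0 = h (tau i) 0%N.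
  by rewrite (relR_bbtau rel) // expr0 mul1r.
pose T := H + K.
have Tx0 : lie T x0 = 0 by rewrite lieDl Hx0 Kx0 subrr.
have Ty0 : lie T y0 = 0 by rewrite lieDl Hy0 Ky0 subrr.
have Tz0 : lie T z0 = z1 *+ 2.
  by rewrite lieDl Hz0 Kz0 -[4%N]/(2 + 2)%N mulrnDr addKr.
have TH : lie T H = 0.
  by rewrite lieDl liexx (lieC K) HK oppr0 addr0.
have Tx1 : lie T x1 = 0.
  by apply: two_inj; rewrite -lieMnr -Hx0; apply: lie_commute_lie.
have Ty1 : lie T y1 = 0.
  by apply: two_inj; rewrite -lieMnr -Hy0; apply: lie_commute_lie.
pose z2 := lie T z1.
(* Apply ad T to [x_1, z_0] = [x_0, z_1]: it passes x_0 and x_1 and acts on the z's only. *)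
have xz2 : lie x1 z1 *+ 2 = lie x0 z2.
  by rewrite -lieMnr -Tz0 -(lie_jacobi_commute z0 Tx1) xz lie_jacobi_commute.
have yz2 : lie y1 z1 *+ 2 = lie y0 z2.
  by rewrite -lieMnr -Tz0 -(lie_jacobi_commute z0 Ty1) yz lie_jacobi_commute.
have z2C : lie (h (tau i) 0%N) z2 = 0.
  have h0h r : (r <= 1)%N -> forall k, lie (h (tau i) 0%N) (h k r) = 0.
    by move=> le_r1 k; apply: (relR_hh rel).
  apply: lie_commute_lie.
    by rewrite lieC lieDl (lieC H) (lieC K) !h0h // oppr0 addr0 oppr0.
  by rewrite (relR_h0b rel) // tauK ctj cij subrr.
(* H + T kills z_0 and commutes with T, so it kills [T, z_0] = 2 z_1. *)
have Hz1 : lie H z1 = - z2.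
  have HTz0 : lie (H + T) z0 = 0 by rewrite lieDl Hz0 Tz0 addNr.
  have : lie (H + T) z1 = 0.
    apply: two_inj; rewrite -lieMnr -Tz0; apply: lie_commute_lie => //.
    by rewrite lieDl lieC TH liexx oppr0 addr0.
  by rewrite lieDl => /eqP; rewrite addr_eq0 => /eqP.
have W0 : lie (lie x1 y1) z0 = 0.
  (* Now [W, z_0] is [x_1, [y_0, z_1]] - [y_1, [x_0, z_1]]. The first two Jacobi identities express
     these terms by [y_0, [x_1, z_1]], [x_0, [y_1, z_1]] and z_2; the third equates the doubles of
     the former two, hence the doubled goal. *)
  apply: two_inj; rewrite lie_lie xz yz.
  have : lie (lie x0 y1) z1 = - z2 by rewrite xy01.
  rewrite lie_lie => /eqP; rewrite subr_eq => /eqP x0y1z1.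
  have : lie (lie x1 y0) z1 = z2 by rewrite xy10 lieNl Hz1 opprK.
  rewrite lie_lie => /eqP; rewrite subr_eq => /eqP ->.
  have : lie (lie x0 y0) z2 = 0 by rewrite xy00.
  rewrite lie_lie -xz2 -yz2 !lieMnr x0y1z1 => /eqP.
  rewrite subr_eq0 => /eqP y0x1z1.
  by rewrite mulrnBl mulrnDl -y0x1z1 -mulrnDl addNKr subrr.
have TW : lie T (lie x1 y1) = 0 by apply: lie_commute_lie.
have W1 : lie (lie x1 y1) z1 = 0.
  apply: two_inj; rewrite -lieMnr -Tz0; apply: lie_commute_lie => //.
  by rewrite lieC TW oppr0.
have WK : lie (lie x1 y1) K = 0 by rewrite -zz; apply: lie_commute_lie.
by move: TW; rewrite lieDl (lieC K) WK oppr0 addr0.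
Qed.

(* The Dynkin diagram D_(m+3): a chain 0 - ... - m whose end m carries two more
   leaves m+1 and m+2.  For m = 0 it is A_3, with middle node 0. *)
Definition adjD (m a b : nat) : bool :=
  edge_D m.+3 a b || edge_D m.+3 b a.

(** * Diagram involutions of D_(m+3), as functions on natural numbers *)

Section Involution.

Local Open Scope nat_scope.

Lemma adjD_noncentral m k a : k != m -> adjD m k a ->
  k < m /\ (a.+1 = k \/ a = k.+1) \/ m < k /\ a = m.
Proof. rewrite /adjD /edge_D; lia. Qed.

Lemma adjD_center m a : adjD m m a -> a.+1 = m \/ a = m.+1 \/ a = m.+2.
Proof. rewrite /adjD /edge_D; lia. Qed.

Lemma adjD_involution (m : nat) (s : nat -> nat) :
    (forall k, k < m.+3 -> s k < m.+3) ->
    (forall k, k < m.+3 -> s (s k) = k) ->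
    (forall k l, k < m.+3 -> l < m.+3 -> adjD m (s k) (s l) = adjD m k l) ->
    (exists2 k, k < m.+3 & s k != k) ->
  exists p w, [/\ p < m.+3, w < m.+3, s p != p & s w = w] /\
    [/\ adjD m p w, ~~ adjD m p (s p) &
     forall k, k < m.+3 -> k != p -> k != s p -> s k = k].
Proof.
move=> slt sK sadj [k0 lt_k0 s_k0].
have s_inj k l : k < m.+3 -> l < m.+3 -> s k = s l -> k = l.
  by move=> lt_k lt_l skl; rewrite -(sK k) // skl sK.
(* If [s m] were a leaf, both [m.+1] and [m.+2] would go to [m]. If [s m < m], then [m.-1] is a
   third neighbour of [m], but [s m] has at most two. *)
have sm : s m = m.
  apply/eqP; apply: contraT => sm.
  have nb a : a < m.+3 -> adjD m m a ->
      s m < m /\ ((s a).+1 = s m \/ s a = (s m).+1) \/ m < s m /\ s a = m.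
    by move=> lt_a ma; apply: adjD_noncentral sm _; rewrite sadj //; lia.
  have nb1 := nb m.+1 ltac:(lia) ltac:(rewrite /adjD /edge_D; lia).
  have nb2 := nb m.+2 ltac:(lia) ltac:(rewrite /adjD /edge_D; lia).
  have n12 := s_inj m.+1 m.+2 ltac:(lia) ltac:(lia).
  have lt_sm : s m < m by lia.
  have nb3 := nb m.-1 ltac:(lia) ltac:(rewrite /adjD /edge_D; lia).
  have n13 := s_inj m.+1 m.-1 ltac:(lia) ltac:(lia).
  have n23 := s_inj m.+2 m.-1 ltac:(lia) ltac:(lia).
  lia.
(* For [m = 1] (type D_4) any two of the three leaves may be exchanged. *)
have [m1|m_neq1] := eqVneq m 1.
  exists k0, m.
  move: sm slt sK s_inj s_k0 lt_k0 {sadj}.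
  rewrite m1 => s1 slt sK s_inj s_k0 lt_k0.
  have lt_s := slt k0 lt_k0.
  have k01 : k0 != 1 by apply: contra s_k0 => /eqP->; rewrite s1.
  have sk01 : s k0 != 1 by apply: contra k01 => /eqP e; rewrite -(sK k0) // e s1.
  split; first by rewrite s1.
  split; rewrite ?/adjD /edge_D; [lia | lia |].
  move=> k lt_k k_k0 k_sk0.
  have [->//|k1] := eqVneq k 1.
  (* 1, [k0], [s k0] and [k] are all four nodes, and [s k] avoids the images of the first three. *)
  have e1 := s_inj k 1 lt_k isT; have e0 := s_inj k k0 lt_k lt_k0.
  have := s_inj k (s k0) lt_k lt_s; rewrite (sK k0) // => e2.
  have := slt k lt_k; lia.
have sfix k : k <= m -> s k = k.
  move=> le_km; rewrite -(subKn le_km); move: (m - k) (leq_subr k m).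
  elim/ltn_ind => -[|[|n]] IH le_n.
  - by rewrite subn0.
  (* Here m >= 2. If [m - 1] went to a leaf, its neighbour [m - 2] would go to the leaf's only
     neighbour [m = s m]. *)
  - have am : adjD m m (s (m - 1)).
      by rewrite -{2}sm sadj ?/adjD /edge_D; lia.
    have nb : adjD m (s (m - 1)) (s (m - 2)).
      by rewrite sadj ?/adjD /edge_D; lia.
    have n02 := s_inj m (m - 2) ltac:(lia) ltac:(lia).
    have [|nm] := adjD_center am; first lia.
    have := @adjD_noncentral m _ _ _ nb; lia.
  (* The fixed node [m - n.+1] has one other neighbour besides the fixed [m - n]. *)
  - have IH1 := IH n.+1 (ltnSn _) (ltnW le_n).
    have IH0 := IH n (ltnW (ltnSn _)) (ltnW (ltnW le_n)).
    have nb : adjD m (m - n.+1) (s (m - n.+2)).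
      by rewrite -IH1 sadj ?/adjD /edge_D; lia.
    have n02 := s_inj (m - n) (m - n.+2) ltac:(lia) ltac:(lia).
    have := @adjD_noncentral m _ _ _ nb; lia.
exists m.+1, m.
have lt_mk k : k < m.+3 -> s k != k -> m < k.
  by move=> _; rewrite ltnNge; apply: contra => /sfix ->.
have sm1 : s m.+1 = m.+2.
  have s_sk0 : s (s k0) != s k0 by rewrite sK // eq_sym.
  have sk0 := slt k0 lt_k0.
  have m_k0 := lt_mk k0 lt_k0 s_k0; have m_sk0 := lt_mk _ sk0 s_sk0.
  have [k0E|k0m1] := eqVneq k0 m.+1.
    by move: s_k0 sk0 m_sk0; rewrite k0E; lia.
  have k0E : k0 = m.+2 by lia.
  have sk0E : s k0 = m.+1 by lia.
  by rewrite -[in LHS]sk0E sK.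
split; first by rewrite sm1; split => //; lia.
split; [by rewrite /adjD /edge_D; lia | by rewrite sm1 /adjD /edge_D; lia |].
by rewrite sm1 => k lt_k k1 k2; apply: sfix; lia.
Qed.

End Involution.

(** * The Cartan form of D_(m+3) and its positivity *)

Definition cartanD (m a b : nat) : int :=
  if a == b then 2 else if adjD m a b then -1 else 0.

Lemma cartanD_eqN1 m a b : (cartanD m a b == -1) = adjD m a b.
Proof.
rewrite /cartanD; case: (eqVneq a b) => [->|_]; last by case: (adjD m a b).
by rewrite /adjD /edge_D; lia.
Qed.

Lemma cartanD_sym m a b : cartanD m a b = cartanD m b a.
Proof. by rewrite /cartanD eq_sym /adjD orbC. Qed.

(** Adding a node to a diagram borders its Cartan matrix; this lets the form be computed node by
    node. *)
Lemma sum_bordered (V : nmodType) n (F : nat -> nat -> V) :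
  \sum_(k < n.+1) \sum_(l < n.+1) F k l =
  \sum_(k < n) \sum_(l < n) F k l + \sum_(k < n) (F k n + F n k) + F n n.
Proof.
rewrite big_ord_recr /=.
under eq_bigr do rewrite big_ord_recr /=.
by rewrite big_ord_recr /= !big_split /= !addrA.
Qed.

Lemma sum_ord_last (V : nmodType) n (F : nat -> V) :
  (forall k, (k < n)%N -> F k = 0) -> \sum_(k < n.+1) F k = F n.
Proof. by move=> F0; rewrite big_ord_recr /= big1 ?add0r // => k _; apply: F0. Qed.

Section CartanForm.

Variables (R : realDomainType) (m : nat) (y : nat -> R).

Let F k l : R := (cartanD m k l)%:~R * y k * y l.

Let F0 k l : k != l -> ~~ adjD m k l -> F k l = 0.
Proof. by rewrite /F /cartanD => /negPf-> /negPf->; rewrite !mul0r. Qed.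

Let F1 k l : adjD m k l -> F k l = - (y k * y l).
Proof.
by rewrite -cartanD_eqN1 /F => /eqP->; rewrite rmorphN1 mulN1r mulNr.
Qed.

Let F2 k : F k k = 2 * y k ^+ 2.
Proof. by rewrite /F /cartanD eqxx expr2 mulrA. Qed.

(** Node n+1 is joined only to n, so it adds 2 y_(n+1)^2 - 2 y_n y_(n+1) = (y_n - y_(n+1))^2 - y_n^2
    + y_(n+1)^2. *)
Lemma cartanD_form_chain n : (n <= m)%N ->
  \sum_(k < n.+1) \sum_(l < n.+1) F k l =
  y 0%N ^+ 2 + \sum_(k < n) (y k - y k.+1) ^+ 2 + y n ^+ 2.
Proof.
elim: n => [_|n IH lt_nm].
  by rewrite !big_ord1 big_ord0 F2; ring.
rewrite sum_bordered IH ?(ltnW lt_nm) //.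
rewrite (sum_ord_last (F := fun k => F k n.+1 + F n.+1 k)); last first.
  by move=> k lt_kn; rewrite !F0 ?addr0 // /adjD /edge_D; lia.
rewrite big_ord_recr /= F2 (F1 (k := n)) ?(F1 (k := n.+1)).
all: by [rewrite /adjD /edge_D; lia | ring].
Qed.

(** With a, b the values at the leaves, the square y_m^2 left over by the chain absorbs their terms:
    y_m^2 - 2 y_m (a + b) + 2 a^2 + 2 b^2 = (y_m - a - b)^2 + (a - b)^2. *)
Lemma cartanD_form :
  \sum_(k < m.+3) \sum_(l < m.+3) F k l =
  y 0%N ^+ 2 + \sum_(k < m) (y k - y k.+1) ^+ 2
  + (y m - y m.+1 - y m.+2) ^+ 2 + (y m.+1 - y m.+2) ^+ 2.
Proof.
have leaf n : (m < n < m.+3)%N ->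
    \sum_(k < m.+1) (F k n + F n k) = - (y m * y n) *+ 2.
  move=> mn; rewrite (sum_ord_last (F := fun k => F k n + F n k)).
    by rewrite !F1 ?(mulrC (y n)) // /adjD /edge_D; lia.
  by move=> k lt_km; rewrite !F0 ?addr0 // /adjD /edge_D; lia.
have -> : \sum_(k < m.+3) \sum_(l < m.+3) F k l =
    \sum_(k < m.+1) \sum_(l < m.+1) F k l - (y m * y m.+1) *+ 2
    + 2 * y m.+1 ^+ 2 - (y m * y m.+2) *+ 2 + 2 * y m.+2 ^+ 2.
  rewrite 2!sum_bordered [X in _ + X + _]big_ord_recr /= !leaf;
    rewrite ?ltnS ?leqnn ?leqnSn //.
  by rewrite !F2 !F0 ?addr0 ?mulNrn // /adjD /edge_D; lia.
rewrite cartanD_form_chain //; ring.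
Qed.

Lemma cartanD_form_gt0 : (exists2 k, (k < m.+3)%N & y k != 0) ->
  0 < \sum_(k < m.+3) \sum_(l < m.+3) F k l.
Proof.
case=> k lt_k yk; rewrite cartanD_form.
have sq_ge0 (z : R) : 0 <= z ^+ 2 by exact: sqr_ge0.
have sum_ge0 : 0 <= \sum_(k < m) (y k - y k.+1) ^+ 2 by apply: sumr_ge0.
rewrite lt_def ?addr_ge0 // andbT; apply: contra yk.
rewrite !paddr_eq0 ?addr_ge0 // !sqrf_eq0.
case/andP=> /andP[/andP[/eqP y0 /eqP ysum] /eqP ym] ym1.
(* All squares vanish: zero spreads from y_0 along the chain, and then the leaf values have both sum
   and difference zero. *)
have ychain l : (l <= m)%N -> y l = 0.
  elim: l => [//|l IH lt_lm].
  have := psumr_eq0P (fun (k : 'I_m) _ => sq_ge0 (y k - y k.+1)) ysum.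
  move=> /(_ (Ordinal lt_lm) isT)/eqP.
  by rewrite /= sqrf_eq0 IH ?(ltnW lt_lm) // sub0r oppr_eq0 => /eqP.
have [/ychain->//|lt_mk] := leqP k m.
have ym0 := ychain m (leqnn m).
have y1 : y m.+1 = y m.+2 by apply/eqP; rewrite -subr_eq0.
have y2 : y m.+2 = 0 by lra.
have [->|] := eqVneq k m.+1; first by rewrite y1 y2.
by move=> k1; rewrite (_ : k = m.+2) ?y2 //; lia.
Qed.

End CartanForm.

(** * Transfer to an abstract diagram labelled by D_(m+3) *)

Section DiagramD.

Variables (I : finType) (c : I -> I -> int) (m : nat).
Variables (f : I -> 'I_m.+3) (g : 'I_m.+3 -> I).
Hypotheses (fK : cancel f g) (gK : cancel g f).
Hypothesis cE : forall i j, c i j = cartanD m (f i) (f j).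

(** [inord] sends labels from m+3 on to 0, hence the bound in [f_node]. *)
Let node k := g (inord k).

Let node_f i : node (f i) = i.
Proof. by rewrite /node inord_val fK. Qed.

Let f_node k : (k < m.+3)%N -> f (node k) = k :> nat.
Proof. by move=> lt_k; rewrite gK inordK. Qed.

Lemma typeD_simply_laced : simply_laced_cartan c.
Proof.
split.
- by apply/card_gt0P; exists (g ord0).
- by move=> i; rewrite cE /cartanD eqxx.
- move=> i j ij; rewrite cE /cartanD ifF; last first.
    by apply/negP => /eqP/val_inj /(can_inj fK)/eqP; apply/negP.
  by case: ifP; [right | left].
- by move=> i j; rewrite !cE cartanD_sym.
- move=> x x0; pose y k := x (node k).
  have -> : \sum_i \sum_j (c i j)%:~R * x i * x j =
      \sum_(k < m.+3) \sum_(l < m.+3) (cartanD m k l)%:~R * y k * y l.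
    rewrite (reindex g) /=; last by exists f => ? _.
    apply: eq_bigr => k _; rewrite (reindex g) /=; last by exists f => ? _.
    by apply: eq_bigr => l _; rewrite cE !gK /y /node !inord_val.
  apply: cartanD_form_gt0.
  have /existsP[i xi] : [exists i, x i != 0].
    apply: contraNT x0; rewrite negb_exists => /forallP x0.
    by apply/eqP/ffunP => i; rewrite ffunE; apply/eqP/negPn/x0.
  by exists (f i); rewrite // /y node_f.
move=> x y _ _.
set e := [rel u v | _].
have e_adj k l : (k < m.+3)%N -> (l < m.+3)%N -> adjD m k l ->
    e (node k) (node l).
  move=> lt_k lt_l; rewrite /e /= !inE cE !f_node // -cartanD_eqN1 => /eqP->.
  by [].
have e_sym : connect_sym e.
  by apply: sym_connect_sym => u v; rewrite /e /= !inE !cE cartanD_sym.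
(* Walk down the chain from the branching node; the leaves are one edge away from it. *)
have center k : (k < m.+3)%N -> connect e (node m) (node k).
  have low l : (l <= m)%N -> connect e (node m) (node (m - l)%N).
    elim: l => [|l IH lt_lm]; first by rewrite subn0.
    apply: connect_trans (IH (ltnW lt_lm)) (connect1 _).
    by apply: e_adj; rewrite ?/adjD /edge_D; lia.
  move=> lt_k; have [le_km|lt_mk] := leqP k m.
    by rewrite -(subKn le_km) low ?leq_subr.
  by apply/connect1/e_adj; rewrite ?/adjD /edge_D; lia.
rewrite -(node_f x) -(node_f y).
by apply: connect_trans (center _ _); rewrite // e_sym center.
Qed.

Lemma typeD_unique_orbit2 (tau : I -> I) :
    nontrivial_diagram_involution c tau ->
  exists p j, [/\ tau p != p, tau j = j, c p (tau p) = 0, c p j = -1 &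
    forall k, k != p -> k != tau p -> tau k = k].
Proof.
case=> tauK tauc [i0 tau_i0].
pose s k : nat := f (tau (node k)).
have node_s k : node (s k) = tau (node k) by rewrite /s node_f.
have slt k : (s k < m.+3)%N by exact: ltn_ord.
have [|k l lt_k lt_l||p [w [[lt_p lt_w sp sw] [adj_pw nadj sfix]]]] :=
    @adjD_involution m s (fun k _ => slt k).
- by move=> k lt_k; rewrite {1}/s node_s tauK f_node.
- by rewrite -!cartanD_eqN1 /s -cE tauc cE !f_node.
- exists (f i0); rewrite // /s node_f; apply: contra tau_i0 => /eqP/val_inj.
  by move/(can_inj fK)/eqP.
exists (node p), (node w); rewrite -!node_s sw.
have node_eq k l : (k < m.+3)%N -> (l < m.+3)%N -> (node k == node l) = (k == l).
  move=> lt_k lt_l; apply/eqP/eqP => [e|->//].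
  by rewrite -(f_node lt_k) e f_node.
rewrite node_eq // !cE !f_node //; split=> //.
- by rewrite /cartanD eq_sym (negPf sp) (negPf nadj).
- by apply/eqP; rewrite cartanD_eqN1.
move=> k; rewrite -(node_f k) !node_eq // => kp ksp.
by rewrite -node_s sfix.
Qed.

End DiagramD.

Lemma typeAD_cartanD (I : finType) (c : I -> I -> int) :
    type_A 3 c \/ (exists r : nat, type_D r c) ->
  exists m (f : I -> 'I_m.+3) (g : 'I_m.+3 -> I),
    [/\ cancel f g, cancel g f & forall i j, c i j = cartanD m (f i) (f j)].
Proof.
case=> [[f [[g fK gK] cE]]|[r [le4r [f [[g fK gK] cE]]]]]; last first.
  have rE : r = (r - 3).+3 by lia.
  move: (r - 3)%N rE => m rE; rewrite {}rE in f g fK gK cE *.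
  by exists m, f, g.
(* The middle node is 1 in [edge_A] but 0 in [cartanD 0], so [t] swaps 0 and 1. *)
pose t (a : 'I_3) : 'I_3 :=
  inord (if a == 0%N :> nat then 1 else if a == 1%N :> nat then 0 else 2)%N.
have tE (a : 'I_3) : t a = (if a == 0%N :> nat then 1
    else if a == 1%N :> nat then 0 else 2)%N :> nat.
  by rewrite /t inordK //; do 2?case: ifP.
have tK : involutive t.
  by move=> a; apply: val_inj; rewrite /= !tE; case: a => -[|[|[|]]].
exists 0%N, (t \o f), (g \o t); split.
- by move=> i /=; rewrite tK fK.
- by move=> k /=; rewrite gK tK.
move=> i j; rewrite cE /= /cartanD !tE.
by case: (f i) (f j) => [[|[|[|]]] ?] // [[|[|[|]]] ?].
Qed.

(** With a single orbit of length 2, either of its nodes represents it, and a singleton is connected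
    by the empty path. *)
Lemma transversal_of_orbit2 (I : finType) (c : I -> I -> int) (tau : I -> I) p :
    involutive tau -> tau p != p ->
    (forall k, k != p -> k != tau p -> tau k = k) ->
  orbits2 tau = [set [set p; tau p]]
  /\ forall i, i \in [set p; tau p] -> connected_representatives c tau [set i].
Proof.
move=> tauK taup fixed.
have movedE : moved_nodes tau = [set p; tau p].
  apply/setP => k; rewrite !inE; apply/idP/orP => [tauk|[]/eqP->//].
    apply/orP; apply: contraR tauk; rewrite negb_or.
    by case/andP=> kp ktp; rewrite fixed.
  by rewrite tauK eq_sym.
have orbE : orbits2 tau = [set [set p; tau p]].
  apply/setP => B; rewrite inE; apply/imsetP/eqP => [[k]|->]; last first.
    by exists p; rewrite // inE.
  by rewrite movedE => /set2P[] -> ->; rewrite // tauK setUC.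
split=> // i iO; split; last by move=> x y /set1P-> /set1P->; apply: connect0.
rewrite orbE movedE; apply/and3P; split.
- apply/and3P; split; first by rewrite /cover big_set1.
    by apply/trivIsetP => B C /set1P-> /set1P->; rewrite eqxx.
  by rewrite inE eq_sym; apply/set0Pn; exists i.
- by rewrite sub1set.
by apply/forall_inP => B /set1P->; rewrite (setIidPl _) ?sub1set ?cards1.
Qed.

Theorem lemma4p9 :
  (forall (R : realType) (I : finType) (c : I -> I -> int) (tau : I -> I)
     (I1 : {set I}) (i j : I) (A : algType R[i]) (h b : I -> nat -> A),
     simply_laced_cartan c ->
     nontrivial_diagram_involution c tau ->
     connected_representatives c tau I1 ->
     lemma_hypotheses c tau I1 i j ->
     relationsR c tau h b ->
     lie (h i 1%N) (lie (b i 1%N) (b (tau i) 1%N)) = 0)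
  /\
  (forall (I : finType) (c : I -> I -> int) (tau : I -> I),
     type_A 3 c \/ (exists r : nat, type_D r c) ->
     nontrivial_diagram_involution c tau ->
     simply_laced_cartan c
     /\ exists O : {set I},
          orbits2 tau = [set O]
          /\ forall i : I, i \in O ->
               connected_representatives c tau [set i]
               /\ exists j : I, lemma_hypotheses c tau [set i] i j).
Proof.
split=> [R I c tau I1 i j A h b cartan invol _ [_ jfix cit [cij _ _ _]] rel|].
  apply: (lie_h1_lie_b1_btau1 _ cartan invol _ cit cij rel).
    by move=> x /eqP; rewrite -scaler_nat scaler_eq0 pnatr_eq0 => /eqP.
  by move: jfix; rewrite inE => /eqP.
move=> I c tau /typeAD_cartanD[m [f [g [fK gK cE]]]] invol.
have cartan := typeD_simply_laced fK gK cE; split=> //.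
have [p [j [taup tauj cpt cpj fixed]]] := typeD_unique_orbit2 fK gK cE invol.
have [tauK tauc _] := invol.
have [orbE repr] := transversal_of_orbit2 c tauK taup fixed.
exists [set p; tau p]; split=> // i iO; split; first exact: repr.
have csym := cartan_sym cartan.
have ctj : c (tau p) j = -1 by rewrite -{1}tauj tauc.
(* The same [j] serves both nodes of the orbit, being fixed by [tau] and hence joined to both. *)
exists j; split; rewrite ?inE ?tauj //.
  by case/set2P: iO => ->; rewrite // tauK csym.
by case/set2P: iO => ->; rewrite ?tauK 2?(csym j).
Qed.
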